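(* Let $P$ be a set of $n\geq 3$ points in general position in the plane, let $D(P)$ be its edge disjointness graph, and let $\kappa(n):=\binom{\lfloor\frac{n-2}{2}\rfloor}{2}+\binom{\lceil\frac{n-2}{2}\rceil}{2}$. Then $\delta(D(P))\geq \kappa(n)$ and $\Delta(D(P))=\binom{n-2}{2}$. If additionally $P$ is in convex position, then $\delta(D(P))=\kappa(n)$.
   Context: A point set in the plane is in general position if no three of its points are collinear. It is in convex position if all of its points lie on the boundary of its convex hull. The edge disjointness graph $D(P)$ is the graph whose vertices are all the closed straight line segments $xy$ with distinct endpoints $x,y\in P$; two vertices are adjacent if and only if the corresponding segments are disjoint. $\delta(H)$ and $\Delta(H)$ denote the minimum and maximum degree of a graph $H$. By convention $\binom{m}{2}=0$ if $m<2$. *)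

(* Defs.v *)
From mathcomp Require Import all_boot all_order all_algebra finmap.
From mathcomp Require Import all_classical all_reals all_analysis.

Set Implicit Arguments.
Unset Strict Implicit.
Unset Printing Implicit Defensive.

Import Order.TTheory GRing.Theory Num.Theory.
Import numFieldNormedType.Exports.

Local Open Scope classical_set_scope.
Local Open Scope ring_scope.

Section Graphs.

Record sgraph := SGraph {
  vertex :> finType;
  edge : rel vertex;
  edge_sym : symmetric edge;
  edge_irr : irreflexive edge }.

Definition degree (G : sgraph) (v : G) : nat := #|[set w : G | edge v w]%SET|.

(* Every degree is smaller than #|G|, so that the default value #|G| is
   immaterial unless G has no vertex. *)
Definition min_degree (G : sgraph) : nat := \big[minn/#|G|]_(v : G) degree v.

Definition max_degree (G : sgraph) : nat := \max_(v : G) degree v.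

End Graphs.

Section Plane.
Variable R : realType.
Local Notation plane := 'rV[R]_2.
Implicit Types (x y z p : plane) (A : set plane) (P : {fset plane}).

Definition line p (v : plane) : set plane := range (fun t : R => p + t *: v).

Definition collinear x y z : Prop :=
  exists p v : plane, v != 0 /\ [set x; y; z] `<=` line p v.

Definition general_position P : Prop :=
  forall x y z, x \in P -> y \in P -> z \in P ->
    x != y -> x != z -> y != z -> ~ collinear x y z.

Definition convex_hull A : set plane :=
  smallest (@convex_set R plane) A.

Definition boundary A : set plane := closure A `\` interior A.

Definition convex_position P : Prop :=
  [set` P] `<=` boundary (convex_hull [set` P]).

Definition segment x y : set plane :=
  [set (1 - t) *: x + t *: y | t in `[0, 1]].

Lemma segment_nonempty x y : segment x y !=set0.
Proof.
by exists ((1 - 0) *: x + 0 *: y), 0 => //=; rewrite in_itv /= lexx ler01.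
Qed.

(* The segments are point sets: xy and yx are the same element. *)
Definition segments P : {fset set plane} :=
  [fset segment e.1 e.2 | e in (P `*` P)%fset & e.1 != e.2]%fset.

Definition disjoint_segments P : rel (segments P) :=
  fun s t => `[< (val s `&` val t : set plane) = set0 >].

Lemma disjoint_segments_sym P : symmetric (@disjoint_segments P).
Proof. by move=> s t; rewrite /disjoint_segments setIC. Qed.

Lemma disjoint_segments_irr P : irreflexive (@disjoint_segments P).
Proof.
move=> s; apply/negbTE/negP => /asboolP; rewrite setIid.
have /imfsetP[e _ ->] := valP s.
by apply/eqP/set0P; exact: segment_nonempty.
Qed.

Definition edge_disjointness_graph P : sgraph :=
  SGraph (@disjoint_segments_sym P) (@disjoint_segments_irr P).

End Plane.

Definition kappa (n : nat) : nat :=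
  'C((n - 2)./2, 2) + 'C(uphalf (n - 2), 2).

(* Main.v *)
Require Import Defs.
From mathcomp Require Import all_boot all_order all_algebra finmap.
From mathcomp Require Import all_classical all_reals all_analysis.
From mathcomp Require Import ring lra zify.

(* The line through the endpoints x, y of a segment splits the other n - 2
   points into a points on its left and b on its right.  Segments with both
   endpoints on one side are disjoint from xy, so that the degree of xy is at
   least C(a,2) + C(b,2), which is at least kappa n by convexity; a disjoint
   segment has its endpoints among the other n - 2 points, so that the degree is
   at most C(n-2,2).  In convex position a segment joining the two sides meets
   xy, so that the degree is exactly C(a,2) + C(b,2).
   Finally, around a point x of maximal norm the other points are linearly
   ordered by angle, hence every split (a, b) is realized by some y: b = 0 yields
   the maximum degree, and the most balanced split yields the minimum degree in
   convex position. *)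

Set Implicit Arguments.
Unset Strict Implicit.
Unset Printing Implicit Defensive.

Import Order.TTheory GRing.Theory Num.Theory.
Import numFieldNormedType.Exports.

(** * Counting pairs, and ranks in finite orders *)

Section Combinatorics.

(** Since [2 * 'C(k, 2) + k = k * k], for a fixed sum [a + b] only the sum of squares matters, and
    the balanced split minimizes it. *)
Lemma two_bins_min (a b m : nat) : a + b = m ->
  'C(m./2, 2) + 'C(uphalf m, 2) <= 'C(a, 2) + 'C(b, 2).
Proof.
have bin2D k : 2 * 'C(k, 2) + k = k * k.
  case: k => // k; have := mul_bin_diag k.+1 1; rewrite bin1 /=; nia.
move=> abm; rewrite -(leq_pmul2l (isT : 0 < 2)) !mulnDr.
have hu : m./2 + uphalf m = m.
  by have := uphalf_half m; have := odd_double_half m; lia.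
have hu1 : uphalf m <= m./2.+1 by rewrite uphalf_half; case: odd; lia.
have hu2 : m./2 <= uphalf m by rewrite uphalf_half; case: odd; lia.
have := bin2D a; have := bin2D b; have := bin2D m./2; have := bin2D (uphalf m).
suff : m./2 * m./2 + uphalf m * uphalf m <= a * a + b * b by lia.
move: m./2 (uphalf m) hu hu1 hu2 => h u hu hu1 hu2.
have [ah|/ltnW ha] := leqP a h.
  have [d da] : exists d, h = a + d by exists (h - a); lia.
  have -> : b = u + d by lia.
  have : d * h <= d * u by rewrite leq_mul2l hu2 orbT.
  by rewrite da; nia.
have [d da] : exists d, a = h + d by exists (a - h); lia.
have ub : u = b + d by lia.
(* Integrality enters here: [u] exceeds [h] by at most 1, while [d] is 0 or at least 1. *)
have : d * u <= d * h + d * d.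
  by case: (posnP d) => [->|d0]; rewrite // -mulnDr leq_mul2l; lia.
by rewrite ub da; nia.
Qed.

Lemma bigminn_le (I : finType) (z : nat) (F : I -> nat) i :
  \big[minn/z]_j F j <= F i.
Proof.
have: i \in index_enum I by exact: mem_index_enum.
elim: (index_enum I) => // j s IHs; rewrite inE big_cons geq_min.
by case/predU1P => [->|/IHs->]; rewrite ?leqnn ?orbT.
Qed.

Lemma leq_bigminn (I : finType) (z m : nat) (F : I -> nat) :
  m <= z -> (forall i, m <= F i) -> m <= \big[minn/z]_j F j.
Proof. by move=> mz mF; elim/big_ind: _ => // x y; rewrite leq_min => -> ->. Qed.

(** A set counted on both sides would lie in [A :&: B], hence be empty, which [0 < k] excludes. *)
Lemma card_draws_disjoint (T : finType) (A B : {set T}) (k : nat) :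
  [disjoint A & B] -> 0 < k ->
  #|[set D : {set T} | ((D \subset A) || (D \subset B)) && (#|D| == k)]| =
  'C(#|A|, k) + 'C(#|B|, k).
Proof.
move=> dAB k_gt0; rewrite -!cards_draws.
rewrite -cardsUI [X in _ = _ + X](_ : _ = 0) ?addn0; last first.
  apply/eqP; rewrite cards_eq0; apply/eqP/setP => D; rewrite !inE.
  apply/negbTE/negP => /andP[/andP[DA /eqP cD] /andP[DB _]].
  have: D \subset A :&: B by rewrite finset.subsetI DA.
  by rewrite (disjoint_setI0 dAB) finset.subset0 -cards_eq0 cD; case: k k_gt0 {cD}.
by apply: eq_card => D; rewrite !inE andb_orl.
Qed.

(** Ranks strictly increase along [lt], so they are [#|A|] distinct numbers below [#|A|], and none
    of these numbers is left out. *)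
Lemma rank_surjective (T : finType) (A : {set T}) (lt : rel T) :
  irreflexive lt ->
  {in A & A & A, forall y x z, lt x y -> lt y z -> lt x z} ->
  {in A &, forall x y, x != y -> lt x y || lt y x} ->
  forall k, k < #|A| -> exists2 q, q \in A & #|[set p in A | lt p q]| = k.
Proof.
move=> ltxx lt_trans lt_total k kA.
pose rank q := #|[set p in A | lt p q]|.
have rank_mono : {in A &, forall x y, lt x y -> rank x < rank y}.
  move=> x y xA yA xy; apply: proper_card; apply/properP; split.
    apply/fintype.subsetP => z; rewrite !inE => /andP[zA zx].
    by rewrite zA (lt_trans x z y).
  by exists x; rewrite !inE ?xA ?xy ?ltxx.
have rank_inj : {in A &, injective rank}.
  move=> x y xA yA xy; apply/eqP/negPn/negP => /(lt_total x y xA yA).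
  by case/orP => [/(rank_mono _ _ xA yA)|/(rank_mono _ _ yA xA)];
    rewrite xy ltnn.
have rank_lt q : q \in A -> rank q < #|A|.
  move=> qA; apply: proper_card; apply/properP; split.
    by apply/fintype.subsetP => z; rewrite inE => /andP[].
  by exists q; rewrite // !inE ltxx andbF.
have Ur : uniq [seq rank q | q <- enum A].
  rewrite map_inj_in_uniq ?enum_uniq // => x y.
  by rewrite !mem_enum; exact: rank_inj.
have sub : {subset [seq rank q | q <- enum A] <= iota 0 #|A|}.
  by move=> _ /mapP[q + ->]; rewrite mem_enum mem_iota => /rank_lt.
have [|_ e] := uniq_min_size Ur sub; first by rewrite size_iota size_map -cardE.
have := e k; rewrite mem_iota kA => /mapP[q]; rewrite mem_enum => qA ->.
by exists q.
Qed.

End Combinatorics.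

(** * Plane geometry: orientation, segments, convex hulls *)

Section Geometry.
Local Open Scope classical_set_scope.
Local Open Scope ring_scope.
Variable R : realType.
Local Notation plane := 'rV[R]_2.
Implicit Types (x y z p q w : plane) (P : {fset plane}).

Lemma plane_eqP x y : x 0 0 = y 0 0 -> x 0 1 = y 0 1 -> x = y.
Proof.
move=> e0 e1; apply/rowP => i.
case: i => -[|[|//]] i2.
  by rewrite (_ : Ordinal i2 = 0); last exact/val_inj.
by rewrite (_ : Ordinal i2 = 1); last exact/val_inj.
Qed.

(** Twice the signed area of the triangle [xyz]: positive when [z] lies to the left of the line
    directed from [x] to [y], zero when the points are collinear. *)
Definition orient x y z : R :=
  (y 0 0 - x 0 0) * (z 0 1 - x 0 1) - (y 0 1 - x 0 1) * (z 0 0 - x 0 0).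

Lemma orient_rot x y z : orient y z x = orient x y z.
Proof. by rewrite /orient; ring. Qed.

Lemma orient_swap x y z : orient y x z = - orient x y z.
Proof. by rewrite /orient; ring. Qed.

Lemma orientC x y z : orient x z y = - orient x y z.
Proof. by rewrite /orient; ring. Qed.

Lemma orientxyx x y : orient x y x = 0.
Proof. by rewrite /orient; ring. Qed.

Lemma orientxyy x y : orient x y y = 0.
Proof. by rewrite /orient; ring. Qed.

(** Signed areas add up when [w] cuts the triangle [xpq] into three; this makes barycentric
    coordinates sum to 1. *)
Lemma orient_sum w x p q :
  orient w p q + orient x w q + orient x p w = orient x p q.
Proof. by rewrite /orient; ring. Qed.

Lemma orient_conv x y p q (t : R) :
  orient x y ((1 - t) *: p + t *: q) = (1 - t) * orient x y p + t * orient x y q.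
Proof. by rewrite /orient !mxE; ring. Qed.

Lemma orient0_collinear x y z : x != y -> orient x y z = 0 -> collinear x y z.
Proof.
move=> xy o0; exists x, (y - x); split; first by rewrite subr_eq0 eq_sym.
suff [t zt] : exists t, z = x + t *: (y - x).
  move=> w [[->|->]|->]; [exists 0|exists 1|exists t] => //=.
    by rewrite scale0r addr0.
  by rewrite scale1r addrC subrK.
(* The parameter [t] is read off from a coordinate in which [x] and [y] differ. *)
have [e0|n0] := eqVneq (y 0 0 - x 0 0) 0.
  have n1 : y 0 1 - x 0 1 != 0.
    apply: contra_neq xy => e1; apply: plane_eqP; apply/eqP.
      by rewrite eq_sym -subr_eq0 e0.
    by rewrite eq_sym -subr_eq0 e1.
  exists ((z 0 1 - x 0 1) / (y 0 1 - x 0 1)).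
  apply: plane_eqP; rewrite !mxE; last by field.
  move: o0; rewrite /orient e0 mul0r sub0r => /eqP.
  by rewrite oppr_eq0 mulf_eq0 (negbTE n1) mulr0 addr0 subr_eq0 => /eqP.
exists ((z 0 0 - x 0 0) / (y 0 0 - x 0 0)).
apply: plane_eqP; rewrite !mxE; first by field.
apply: (mulfI n0); move/eqP: o0; rewrite /orient subr_eq0 => /eqP o0.
transitivity ((y 0 0 - x 0 0) * x 0 1 + (y 0 0 - x 0 0) * (z 0 1 - x 0 1)).
  by ring.
by rewrite o0; field.
Qed.

Lemma segment_left x y : segment x y x.
Proof.
by exists 0; rewrite /= ?in_itv /= ?lexx ?ler01 // subr0 scale1r scale0r addr0.
Qed.

Lemma segmentC x y : segment x y = segment y x.
Proof.
suff sub (u v : plane) : segment u v `<=` segment v u by apply/seteqP.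
move=> w [t /=]; rewrite in_itv /= => /andP[t0 t1] <-.
exists (1 - t); first by rewrite /= in_itv /= subr_ge0 t1 gerBl.
by rewrite subKr addrC.
Qed.

Lemma segment_right x y : segment x y y.
Proof. by rewrite segmentC; exact: segment_left. Qed.

Lemma segment_collinear x y p : x != y -> segment x y p -> collinear x y p.
Proof.
move=> xy [t _ <-]; apply: orient0_collinear => //.
by rewrite orient_conv orientxyx orientxyy !mulr0 addr0.
Qed.

(* Being affine, [orient x y] keeps a strict sign on [pq], and it vanishes
   on [xy]. *)
Lemma same_side_disjoint x y p q :
  0 < orient x y p * orient x y q -> segment x y `&` segment p q = set0.
Proof.
move=> pq; apply/seteqP; split => // w [[t _ <-]] [s].
rewrite /= in_itv /= => /andP[s0 s1].
move/(congr1 (orient x y)).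
rewrite !orient_conv orientxyx orientxyy !mulr0 addr0.
move: pq; move: (orient x y p) (orient x y q) => a b ab e.
have [a0|a0|a0] := ltgtP a 0; last by rewrite a0 mul0r ltxx in ab.
  have b0 : b < 0 by rewrite nmulr_rgt0 in ab.
  by nra.
have b0 : 0 < b by rewrite pmulr_rgt0 in ab.
by nra.
Qed.

(** Cramer's rule, the determinants being signed areas. *)
Lemma barycentric x p q w : orient x p q != 0 ->
  w = (orient w p q / orient x p q) *: x + (orient x w q / orient x p q) *: p
      + (orient x p w / orient x p q) *: q.
Proof.
move=> n0; apply: plane_eqP; rewrite !mxE;
  by move: n0; rewrite /orient => n0; field.
Qed.

Lemma orient_continuous p q : continuous (fun w => orient w p q).
Proof.
move=> w.
have c0 : {for w, continuous (fun z : plane => z 0 0)}.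
  exact: coord_continuous.
have c1 : {for w, continuous (fun z : plane => z 0 1)}.
  exact: coord_continuous.
have ca (a : R) : {for w, continuous (fun z : plane => a)}.
  exact: cst_continuous.
have d0 a := continuousB (ca a) c0; have d1 a := continuousB (ca a) c1.
exact: continuousB (continuousM (d0 (p 0 0)) (d1 (q 0 1)))
                   (continuousM (d1 (p 0 1)) (d0 (q 0 0))).
Qed.

Lemma convex_hull_conv (A : set plane) x y (t : R) : 0 <= t <= 1 ->
  convex_hull A x -> convex_hull A y -> convex_hull A (t *: x + (1 - t) *: y).
Proof.
move=> /andP[t0 t1] Ax Ay B [cB AB].
have := cB x y (Itv01 t0 t1); rewrite !inE /=; apply.
  exact: Ax.
exact: Ay.
Qed.

Lemma convex_hull_triangle (A : set plane) x p q (a b c : R) :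
  A x -> A p -> A q -> 0 <= a -> 0 <= b -> 0 < c -> a + b + c = 1 ->
  convex_hull A (a *: x + b *: p + c *: q).
Proof.
move=> Ax Ap Aq a0 b0 c0 abc.
have hull z : A z -> convex_hull A z by exact: sub_gen_smallest.
have bc0 : b + c != 0 by lra.
(* Two nested binary combinations: [x] with a point of the segment [pq]. The hypothesis [0 < c]
   keeps [b + c] nonzero. *)
rewrite (_ : _ + _ = a *: x +
  (1 - a) *: ((b / (b + c)) *: p + (1 - b / (b + c)) *: q)).
  apply: convex_hull_conv; [lra|exact: hull|].
  apply: convex_hull_conv; [|exact: hull|exact: hull].
  rewrite divr_ge0 ?ler_pdivrMr ?mul1r; lra.
have -> : 1 - a = b + c by lra.
rewrite -addrA scalerDr !scalerA; congr (_ + (_ *: _ + _ *: _)); by field.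
Qed.

(** By continuity the three orientations stay positive near [w], so all nearby points have positive
    barycentric coordinates in the triangle [xpq]. *)
Lemma interior_convex_hull (A : set plane) x p q w : A x -> A p -> A q ->
  0 < orient w p q -> 0 < orient x w q -> 0 < orient x p w ->
  interior (convex_hull A) w.
Proof.
move=> Ax Ap Aq o1 o2 o3.
have o0 : 0 < orient x p q by have := orient_sum w x p q; lra.
have near_gt (u v : plane) : 0 < orient w u v -> \forall z \near w, 0 < orient z u v.
  by move=> o; apply: (cvgr_gt _ (@orient_continuous u v w)).
(* The moving point is rotated into the first argument, where continuity is available. *)
rewrite orient_rot in o3; rewrite -orient_rot in o2.
near=> z.
rewrite (@barycentric x p q z) ?gt_eqF //; apply: convex_hull_triangle => //.
- by rewrite divr_ge0 ?ltW //; near: z; exact: near_gt.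
- by rewrite divr_ge0 ?ltW // -orient_rot; near: z; exact: near_gt.
- by rewrite divr_gt0 // orient_rot; near: z; exact: near_gt.
- by rewrite -!mulrDl orient_sum divff // gt_eqF.
Unshelve. all: by end_near. Qed.

(* If [xy] missed [pq] then [y] would lie inside the triangle [xpq], or [x]
   inside the triangle [ypq]. *)
Lemma opposite_sides_meet P x y p q : convex_position P ->
  x \in P -> y \in P -> p \in P -> q \in P ->
  0 < orient x y p -> orient x y q < 0 -> segment x y `&` segment p q !=set0.
Proof.
move=> cP xP yP pP qP op oq.
have notint w : w \in P -> ~ interior (convex_hull [set` P]) w by case/cP.
have yl : 0 <= orient y p q.
  rewrite leNgt; apply/negP => oy; apply: (notint y yP).
  apply: (@interior_convex_hull _ x q p) => //.
  - by rewrite orientC oppr_gt0.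
  - by rewrite orientC oppr_gt0.
have xl : orient x p q <= 0.
  rewrite leNgt; apply/negP => ox; apply: (notint x xP).
  apply: (@interior_convex_hull _ y p q) => //.
  - by rewrite orient_swap oppr_gt0.
  - by rewrite orientC orient_swap opprK.
have e : orient y p q - orient x p q = orient x y p - orient x y q.
  by rewrite /orient; ring.
have s0 : orient x y p - orient x y q != 0 by lra.
(* Along [pq] the affine map [orient x y] falls from a positive to a negative value; this is its
   zero. *)
exists ((1 - orient x y p / (orient x y p - orient x y q)) *: p +
        (orient x y p / (orient x y p - orient x y q)) *: q); split; last first.
  exists (orient x y p / (orient x y p - orient x y q)) => //=.
  by rewrite in_itv /= divr_ge0 ?ler_pdivrMr ?mul1r; lra.
(* Along [xy] the value of [orient _ p q] rises from [orient x p q] to [orient y p q]; this is its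
   zero, the denominator being rewritten by [e]. *)
exists (- orient x p q / (orient x y p - orient x y q)).
  rewrite /= in_itv /= divr_ge0 ?ler_pdivrMr ?mul1r; lra.
by apply: plane_eqP; rewrite !mxE; move: s0; rewrite /orient => s0; field.
Qed.

End Geometry.

(** * Degrees in the edge disjointness graph *)

Section DisjointnessGraph.
Local Open Scope ring_scope.
Variables (R : realType) (P : {fset 'rV[R]_2}).
Hypothesis gpP : general_position P.
Local Notation G := (edge_disjointness_graph P).
Implicit Types (x y z p q : P) (A : {set P}) (s t : segments P).

Definition left_side x y : {set P} :=
  [set p : P | 0 < orient (val x) (val y) (val p)]%SET.

Definition right_side x y : {set P} :=
  [set p : P | orient (val x) (val y) (val p) < 0]%SET.

(** A vertex is a bare point set. General position keeps every third point of [P] off it, so this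
    recovers its two ends. *)
Definition endpoints s : {set P} := [set p : P | `[< val s (val p) >]]%SET.

Lemma not_collinear x y z :
  x != y -> x != z -> y != z -> ~ collinear (val x) (val y) (val z).
Proof.
by move=> xy xz yz; apply: gpP; rewrite ?(inj_eq val_inj) //; exact: valP.
Qed.

Lemma orient_neq0 x y z :
  x != y -> x != z -> y != z -> orient (val x) (val y) (val z) != 0.
Proof.
move=> xy xz yz; apply/eqP => /orient0_collinear o.
by apply: (not_collinear xy xz yz); apply: o; rewrite (inj_eq val_inj).
Qed.

Lemma sides_disjoint x y : [disjoint left_side x y & right_side x y].
Proof.
rewrite -setI_eq0; apply/eqP/setP => p; rewrite !inE.
by case: ltgtP.
Qed.

Lemma sides_setU x y : x != y ->
  (left_side x y :|: right_side x y)%SET = (~: [set x; y])%SET.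
Proof.
move=> xy; apply/setP => p; rewrite !inE negb_or.
have [->|px] /= := eqVneq p x; first by rewrite orientxyx ltxx.
have [->|py] /= := eqVneq p y; first by rewrite orientxyy ltxx.
by rewrite -neq_lt eq_sym orient_neq0 // eq_sym.
Qed.

Lemma card_sides x y : x != y ->
  (#|left_side x y| + #|right_side x y| = #|{: P}| - 2)%N.
Proof.
move=> xy; rewrite -cardsUI (disjoint_setI0 (sides_disjoint x y)) cards0 addn0.
by rewrite sides_setU // cardsCs finset.setCK cards2 xy.
Qed.

Lemma segmentsP s :
  exists x y, x != y /\ val s = segment (val x) (val y).
Proof.
have /imfsetP[[u v] /=] := valP s.
rewrite !inE /= => /andP[/andP[uP vP] uv] ->.
by exists [` uP]%fset, [` vP]%fset; split.
Qed.

Lemma segments_exist x y : x != y ->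
  exists s, val s = segment (val x) (val y).
Proof.
move=> xy.
suff sP : segment (val x) (val y) \in segments P by exists [` sP]%fset.
apply/imfsetP; exists (val x, val y) => //=.
by rewrite !inE /= !(valP x, valP y) /= (inj_eq val_inj).
Qed.

Lemma endpointsE s x y : x != y -> val s = segment (val x) (val y) ->
  endpoints s = [set x; y]%SET.
Proof.
move=> xy sE; apply/setP => p; rewrite !inE.
apply/asboolP/idP; rewrite sE.
  move=> sp; apply: contraT; rewrite negb_or => /andP[px py].
  case: (@not_collinear x y p); rewrite // 1?eq_sym //.
  by apply: segment_collinear; rewrite ?(inj_eq val_inj).
by case/orP => /eqP ->; [exact: segment_left|exact: segment_right].
Qed.

Lemma endpoints_inj : injective endpoints.
Proof.
move=> s t; have [x [y [xy sE]]] := segmentsP s.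
have [x' [y' [xy' tE]]] := segmentsP t.
rewrite (endpointsE xy sE) (endpointsE xy' tE) => e.
apply: val_inj; rewrite sE tE.
have : x \in [set x'; y']%SET by rewrite -e !inE eqxx.
have : y \in [set x'; y']%SET by rewrite -e !inE eqxx orbT.
rewrite !inE => /orP[]/eqP ey /orP[]/eqP ex; subst x y => //.
- by rewrite eqxx in xy.
- by rewrite segmentC.
- by rewrite eqxx in xy.
Qed.

(** Neighbours are encoded as 2-subsets of [P], so that degree bounds become inclusions between
    families counted by binomials. *)
Definition neighbour_ends s : {set {set P}} :=
  (endpoints @: [set t : G | @edge G s t])%SET.

Lemma degreeE s : @degree G s = #|neighbour_ends s|.
Proof. by rewrite card_imset //; exact: endpoints_inj. Qed.

Lemma neighbour_endsP s x y p q :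
  val s = segment (val x) (val y) -> p != q ->
  ([set p; q]%SET \in neighbour_ends s) =
  `[< (segment (val x) (val y) `&` segment (val p) (val q) = set0)%classic >].
Proof.
move=> sE pq; have [t tE] := segments_exist pq.
rewrite -(endpointsE pq tE) mem_imset; last exact: endpoints_inj.
by rewrite inE /= /disjoint_segments sE tE.
Qed.

Lemma neighbour_ends_card2 s A : A \in neighbour_ends s -> #|A| == 2.
Proof.
case/imsetP => t _ ->; have [x [y [xy tE]]] := segmentsP t.
by rewrite (endpointsE xy tE) cards2 xy.
Qed.

(** A shared endpoint would be a common point of the two segments. *)
Lemma neighbour_ends_sub s x y A : x != y ->
  val s = segment (val x) (val y) -> A \in neighbour_ends s ->
  A \subset (~: [set x; y])%SET.
Proof.
move=> xy sE As; have [p [q [pq AE]]] := cards2P _ (neighbour_ends_card2 As).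
rewrite {A}AE in As *.
move: As; rewrite (neighbour_endsP sE pq) => /asboolP disj.
apply/fintype.subsetP => z zpq; rewrite finset.inE; apply/negP => zxy.
have : (segment (val x) (val y) `&` segment (val p) (val q))%classic (val z).
  by move: zxy zpq; rewrite !inE => /orP[]/eqP -> /orP[]/eqP ->; split;
    do ?[exact: segment_left|exact: segment_right].
by rewrite disj.
Qed.

Lemma degree_le s : (@degree G s <= 'C(#|{: P}| - 2, 2))%N.
Proof.
have [x [y [xy sE]]] := segmentsP s.
have -> : (#|{: P}| - 2)%N = #|(~: [set x; y])%SET|.
  by rewrite [RHS]cardsCs finset.setCK cards2 xy.
rewrite degreeE -cards_draws; apply/subset_leq_card/fintype.subsetP => A As.
by rewrite inE (neighbour_ends_sub xy sE As) (neighbour_ends_card2 As).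
Qed.

Lemma degree_ge s x y : x != y -> val s = segment (val x) (val y) ->
  ('C(#|left_side x y|, 2) + 'C(#|right_side x y|, 2) <= @degree G s)%N.
Proof.
move=> xy sE; rewrite degreeE -card_draws_disjoint ?sides_disjoint //.
apply/subset_leq_card/fintype.subsetP => A; rewrite inE => /andP[AS A2].
have [p [q [pq AE]]] := cards2P _ A2; rewrite {A A2}AE in AS *.
rewrite (neighbour_endsP sE pq); apply/asboolP/same_side_disjoint.
have [pA qA] : p \in [set p; q]%SET /\ q \in [set p; q]%SET.
  by rewrite !inE !eqxx orbT.
case/orP: AS => /fintype.subsetP AS; have := AS p pA; have := AS q qA;
  rewrite !inE => oq op.
  exact: mulr_gt0.
by rewrite nmulr_rgt0.
Qed.

(** The ends of a neighbour avoid [x] and [y], so each lies strictly on one side; ends on opposite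
    sides would give a segment meeting [xy]. *)
Lemma degree_convex s x y : convex_position P ->
  x != y -> val s = segment (val x) (val y) ->
  @degree G s = ('C(#|left_side x y|, 2) + 'C(#|right_side x y|, 2))%N.
Proof.
move=> cP xy sE; apply/eqP; rewrite eqn_leq degree_ge // andbT.
rewrite degreeE -card_draws_disjoint ?sides_disjoint //.
apply/subset_leq_card/fintype.subsetP => A As.
have A2 := neighbour_ends_card2 As; rewrite inE A2 andbT.
have [p [q [pq AE]]] := cards2P _ A2; rewrite {A A2}AE in As *.
have /fintype.subsetP := neighbour_ends_sub xy sE As.
rewrite -sides_setU // => sub.
have := sub p; have := sub q; rewrite !inE !eqxx orbT /= => /(_ isT) oq /(_ isT) op.
move: As; rewrite (neighbour_endsP sE pq) => /asboolP disj.
have meet (u v : P) : 0 < orient (val x) (val y) (val u) ->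
    orient (val x) (val y) (val v) < 0 ->
    (segment (val x) (val y) `&` segment (val u) (val v) <> set0)%classic.
  by move=> ou ov; apply/eqP/set0P;
    exact: opposite_sides_meet cP (valP x) (valP y) (valP u) (valP v) ou ov.
rewrite !finset.subUset !finset.sub1set !inE.
case/orP: op => op; case/orP: oq => oq; rewrite ?op ?oq ?orbT //.
  by case: (meet p q).
by case: (meet q p); rewrite // (segmentC (val q)).
Qed.

(** * Realizing every split by an angular order around an extreme point *)

Lemma exists_side_split (k : nat) : (k <= #|{: P}| - 2)%N -> (3 <= #|{: P}|)%N ->
  exists x y, [/\ x != y, #|right_side x y| = k
    & #|left_side x y| = (#|{: P}| - 2 - k)%N].
Proof.
move=> kP P3.
have [x0 _] : exists x : P, x \in {: P}.
  by apply/card_gt0P; rewrite (leq_trans _ P3).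
pose sqn (z : P) := val z 0 0 ^+ 2 + val z 0 1 ^+ 2.
have [x _ xmax] := @Order.TotalTheory.arg_maxP _ _ _ x0 predT sqn isT.
(* All points but [x] lie in an open half-plane bounded by a line through [x];
   [height] is the distance to that line up to a factor. *)
pose height (z : P) :=
  val x 0 0 * (val x 0 0 - val z 0 0) + val x 0 1 * (val x 0 1 - val z 0 1).
(* Twice the height is [|x|^2 - |z|^2 + |x - z|^2], and [x] has maximal norm. *)
have height_gt0 z : z != x -> 0 < height z.
  move=> zx; have := xmax z isT; rewrite /sqn /= => le_zx.
  have : val z 0 0 - val x 0 0 != 0 \/ val z 0 1 - val x 0 1 != 0.
    apply/orP; rewrite -negb_and !subr_eq0.
    apply: contraNN zx => /andP[/eqP e0 /eqP e1].
    by apply/eqP/val_inj/plane_eqP.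
  rewrite /height => -[d|d].
    have : 0 < (val z 0 0 - val x 0 0) ^+ 2 by rewrite exprn_even_gt0.
    by have := sqr_ge0 (val z 0 1 - val x 0 1); rewrite !sqrrB; nra.
  have : 0 < (val z 0 1 - val x 0 1) ^+ 2 by rewrite exprn_even_gt0.
  by have := sqr_ge0 (val z 0 0 - val x 0 0); rewrite !sqrrB; nra.
(* Counterclockwise order around [x]; it is transitive because the points seen from [x] span less
   than a half-turn. *)
pose before p q := 0 < orient (val x) (val p) (val q).
have before_irr : irreflexive before by move=> p; rewrite /before orientxyy ltxx.
have cA : #|[set~ x]%SET| = (#|{: P}|).-1 by rewrite cardsC1.
have kA : (k < #|[set~ x]%SET|)%N by rewrite cA; lia.
have [||y yx ky] := rank_surjective before_irr _ _ kA.
- move=> q p r; rewrite !inE => qx px rx pq qr.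
  (* The linear relation between three vectors of the plane, evaluated by [height]; positive heights
     then carry the signs over. *)
  have e : height q * orient (val x) (val p) (val r) =
      height r * orient (val x) (val p) (val q) +
      height p * orient (val x) (val q) (val r).
    by rewrite /height /orient; ring.
  have hq := height_gt0 q qx.
  by rewrite /before -(pmulr_rgt0 _ hq) e addr_gt0 // mulr_gt0 // height_gt0.
- move=> p q; rewrite !inE => px qx pq.
  rewrite /before [in X in _ || X]orientC oppr_gt0.
  by rewrite orbC -neq_lt orient_neq0 // eq_sym.
rewrite !inE in yx; have xy : x != y by rewrite eq_sym.
have rE : #|right_side x y| = k.
  (* The points to the right of [xy] are those before [y], so the rank of [y] is the size of the
     right side. *)
  rewrite -ky; apply: eq_card => p; rewrite !inE /before [in RHS]orientC oppr_gt0.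
  have [->|] //= := eqVneq p x; first by rewrite orientxyx ltxx.
exists x, y; split => //.
by have := card_sides xy; rewrite rE => <-; rewrite addnK.
Qed.

End DisjointnessGraph.

Theorem proposition1 (R : realType) (n : nat) (P : {fset 'rV[R]_2})
    (n_ge3 : (3 <= n)%N) (cardP : #|` P| = n) (gpP : general_position P) :
  [/\ (kappa n <= min_degree (edge_disjointness_graph P))%N,
      max_degree (edge_disjointness_graph P) = 'C(n - 2, 2)
    & convex_position P ->
      min_degree (edge_disjointness_graph P) = kappa n].
Proof.
set G := edge_disjointness_graph P.
have nE : #|{: P}| = n by rewrite -cardP cardfE.
have kappa_le (s : G) : kappa n <= degree s.
  have [x [y [xy sE]]] := segmentsP s.
  apply: leq_trans (degree_ge gpP xy sE); apply: two_bins_min.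
  by rewrite card_sides // nE.
have split_segment k : k <= n - 2 -> exists (s : G) (x y : P),
    [/\ x != y, val s = segment (val x) (val y), #|right_side x y| = k
      & #|left_side x y| = n - 2 - k].
  rewrite -nE => kn.
  have P_ge3 : 3 <= #|{: P}| by rewrite nE.
  have [x [y [xy rE lE]]] := exists_side_split gpP kn P_ge3.
  by have [s sE] := segments_exist xy; exists s, x, y.
have minP : kappa n <= min_degree G.
  apply: (leq_bigminn _ kappa_le).
  (* The default value [#|G|] of the minimum must also be at least [kappa n]; any vertex shows it,
     its degree being at most [#|G|]. *)
  have [s _] := split_segment 0 (leq0n _).
  exact: leq_trans (kappa_le s) (max_card _).
split=> //.
  apply/eqP; rewrite eqn_leq; apply/andP; split.
    by apply/bigmax_leqP => s _; rewrite -nE degree_le.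
  (* With nothing on the right, all [n - 2] other points are on the left. *)
  have [s [x [y [xy sE rE lE]]]] := split_segment 0 (leq0n _).
  apply: leq_trans (leq_bigmax s); apply: leq_trans (degree_ge gpP xy sE).
  by rewrite rE lE subn0 addn0.
move=> cP; apply/eqP; rewrite eqn_leq minP andbT.
(* The balanced split: the floor of half of [n - 2] on the right, the ceiling on the left. *)
have [|s [x [y [xy sE rE lE]]]] := split_segment (n - 2)./2; first by lia.
apply: leq_trans (bigminn_le _ _ s) _.
rewrite (degree_convex gpP cP xy sE) rE lE /kappa addnC.
by rewrite (_ : uphalf _ = n - 2 - (n - 2)./2) //; rewrite uphalf_half; lia.
Qed.
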